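(* Let $M>m>0$ be real numbers, let $\mathcal{H}$ be a complex Hilbert space and let $C_{M,m}:\mathcal{B}(\mathcal{H})\to\mathcal{B}(\mathcal{H})$ be given by $C_{M,m}(A)=(MI-A^* )(A-mI)$. Then for every $A\in\mathcal{B}(\mathcal{H})$: (1) $C_{M,m}(A^* )=(C_{M,m}(A))^*$ if and only if $A$ is normal. (2) $C_{M,m}(A)=(C_{M,m}(A))^*$ if and only if $A$ is self-adjoint. (3) $C_{M,m}(|A|)$ is accretive if and only if $mI\le |A|\le MI$. (4) $\mathfrak{R}\,C_{M,m}(\mathrm{i}A^* )\le \left(\frac{M-m}{2}\right)^2 I$ and $\mathfrak{R}\,C_{M,m}(A)\le \left(\frac{M-m}{2}\right)^2 I$. (5) $\mathfrak{I}\,C_{M,m}(A)\ge 0$ if and only if $\mathfrak{I}A\ge 0$. (6) If $\mathfrak{R}\,C_{M,m}(A)\ge 0$, then $\mathfrak{R}A\ge 0$. (7) If $C_{M,m}(A)$ is accretive-dissipative, then $A$ is accretive-dissipative.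
   Context: $\mathcal{B}(\mathcal{H})$ is the $C^*$-algebra of bounded linear operators on $\mathcal{H}$, with identity $I$; $|A|=(A^*A)^{1/2}$; $\mathfrak{R}A=\frac{A+A^*}{2}$ and $\mathfrak{I}A=\frac{A-A^*}{2\mathrm{i}}$. For self-adjoint $S,T$, $S\le T$ means $\langle (T-S)x,x\rangle\ge 0$ for all $x\in\mathcal{H}$. An operator $T$ is accretive if $\mathfrak{R}T\ge 0$, dissipative if $\mathfrak{I}T\ge 0$, and accretive-dissipative if both $\mathfrak{R}T\ge0$ and $\mathfrak{I}T\ge 0$. *)

(* Defs.v *)
From HB Require Import structures.
From mathcomp Require Import all_boot all_order all_algebra.
From mathcomp Require Import sesquilinear complex.
From mathcomp Require Import boolp classical_sets functions reals.
From mathcomp Require Import topology normedtype.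

Set Implicit Arguments.
Unset Strict Implicit.
Unset Printing Implicit Defensive.

Import Order.TTheory GRing.Theory Num.Theory.
Import numFieldNormedType.Exports.

Local Open Scope classical_set_scope.
Local Open Scope ring_scope.
Local Open Scope complex_scope.

(* The inner product is linear in its first argument, conjugate-linear in the
   second; [inner_normE] makes the norm, hence the completeness, the one induced
   by it. The zero space is allowed. *)
HB.mixin Record NormedModule_hasInner (R : realType) H
    of CompleteNormedModule R[i] H := {
  inner : {dot H for (@Num.conj R[i])} ;
  inner_normE : forall x : H, `|x| ^+ 2 = inner x x
}.

#[short(type="hilbertType")]
HB.structure Definition Hilbert (R : realType) :=
  {H of CompleteNormedModule R[i] H & NormedModule_hasInner R H}.

Section BoundedOperators.
Context {R : realType} (H : hilbertType R).
Implicit Types (f g : H -> H).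

Definition bounded_linear : {pred H -> H} :=
  [pred f | `[< linear f /\ exists k : R, forall x, `|f x| <= k%:C * `|x| >]].

Lemma bounded_linearP f :
  reflect (linear f /\ exists k : R, forall x, `|f x| <= k%:C * `|x|)
          (f \in bounded_linear).
Proof. exact: asboolP. Qed.

Lemma bounded_linear_submod_closed : submod_closed bounded_linear.
Proof.
split.
  apply/bounded_linearP; split; first by move=> a x y; rewrite /= scaler0 addr0.
  by exists 0 => x; rewrite mul0r normr0.
move=> c f g /bounded_linearP[lf [k fk]] /bounded_linearP[lg [l gl]].
apply/bounded_linearP; split.
  move=> a x y; change (c *: f (a *: x + y) + g (a *: x + y) =
    a *: (c *: f x + g x) + (c *: f y + g y)).
  by rewrite lf lg !scalerDr !scalerA (mulrC c a) addrACA.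
have [r cr] : exists r : R, `|c| = r%:C.
  by exists (complex.Re `|c|); rewrite RRe_real ?normr_real.
exists (r * k + l) => x.
change (`|c *: f x + g x| <= (r * k + l)%:C * `|x|).
rewrite rmorphD rmorphM/= -cr mulrDl.
rewrite (le_trans (ler_normD _ _))// lerD//.
by rewrite normrZ -mulrA ler_wpM2l.
Qed.

HB.instance Definition _ := GRing.isSubmodClosed.Build _ _ bounded_linear
  bounded_linear_submod_closed.

(* B(H). Composition makes it only a [pzRingType] (not an [algType], which needs
   1 != 0), since H may be the zero space; the identity I is 1. *)
Record bop := Bop { bop_fun :> H -> H ; _ : bop_fun \in bounded_linear }.

HB.instance Definition _ := [isSub for bop_fun].
HB.instance Definition _ := [Choice of bop by <:].
HB.instance Definition _ := [SubChoice_isSubLmodule of bop by <:].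

Lemma bounded_linear_id : (fun x : H => x) \in bounded_linear.
Proof.
by apply/bounded_linearP; split=> //; exists 1 => x; rewrite mul1r.
Qed.

Lemma bounded_linear_comp f g :
  f \in bounded_linear -> g \in bounded_linear ->
  (fun x => f (g x)) \in bounded_linear.
Proof.
move=> /bounded_linearP[lf [k fk]] /bounded_linearP[lg [l gl]].
apply/bounded_linearP; split; first by move=> a x y; rewrite lg lf.
exists (`|k| * l) => x; rewrite rmorphM/= -mulrA.
rewrite (le_trans (fk _))//.
rewrite (@le_trans _ _ (`|k|%:C * `|g x|))//.
  by rewrite ler_wpM2r// lecR ler_norm.
by rewrite ler_wpM2l// lecR.
Qed.

Implicit Types (A B S T : bop).

Definition bop_one : bop := Bop bounded_linear_id.
Definition bop_mul A B : bop :=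
  Bop (bounded_linear_comp (valP A) (valP B)).

Lemma bopP A B : (forall x, bop_fun A x = bop_fun B x) -> A = B.
Proof. by move=> AB; apply/val_inj/funext. Qed.

Lemma bop_linear A : linear (bop_fun A).
Proof. by have /bounded_linearP[] := valP A. Qed.

HB.instance Definition _ A := GRing.isLinear.Build R[i] H H *:%R (bop_fun A)
  (bop_linear A).

Lemma bop_mulA : associative bop_mul. Proof. by move=> A B C; exact: bopP. Qed.
Lemma bop_mul1r : left_id bop_one bop_mul. Proof. by move=> A; exact: bopP. Qed.
Lemma bop_mulr1 : right_id bop_one bop_mul. Proof. by move=> A; exact: bopP. Qed.
Lemma bop_mulDl : left_distributive bop_mul +%R.
Proof. by move=> A B C; exact: bopP. Qed.
Lemma bop_mulDr : right_distributive bop_mul +%R.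
Proof. by move=> A B C; apply: bopP => x; exact: (linearD (bop_fun A)). Qed.

HB.instance Definition _ := GRing.Zmodule_isPzRing.Build bop
  bop_mulA bop_mul1r bop_mulr1 bop_mulDl bop_mulDr.

Lemma bop_scalerAl (a : R[i]) A B : a *: (A * B) = a *: A * B.
Proof. exact: bopP. Qed.

Lemma bop_scalerAr (a : R[i]) A B : a *: (A * B) = A * (a *: B).
Proof. by apply: bopP => x; exact/esym/(linearZ_LR (bop_fun A)). Qed.

Definition scalar_bop (a : R) : bop := a%:C *: (1 : bop).

(* The set over which the choice is made has exactly one element, by the Riesz
   representation theorem. *)
Definition adjoint A : bop :=
  xget 0 [set B : bop | forall x y : H, inner (A x) y = inner x (B y)].

(* S <= T for self-adjoint S and T. In R[i], 0 <= z says that z is real and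
   nonnegative. *)
Definition le_bop S T : Prop := forall x : H, 0 <= inner ((T - S) x) x.

(* For T >= 0 there is exactly one S >= 0 with S^2 = T. *)
Definition sqrt_bop T : bop := xget 0 [set S : bop | le_bop 0 S /\ S * S = T].

Definition abs_bop A : bop := sqrt_bop (adjoint A * A).

Definition Re_bop A : bop := 2^-1 *: (A + adjoint A).
Definition Im_bop A : bop := (2 * 'i)^-1 *: (A - adjoint A).

Definition selfadjoint A : Prop := adjoint A = A.
Definition normal_bop A : Prop := adjoint A * A = A * adjoint A.
Definition accretive A : Prop := le_bop 0 (Re_bop A).
Definition dissipative A : Prop := le_bop 0 (Im_bop A).
Definition accretive_dissipative A : Prop := accretive A /\ dissipative A.

Definition Ctransform (M m : R) A : bop :=
  (scalar_bop M - adjoint A) * (A - scalar_bop m).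

End BoundedOperators.

Reserved Notation "a %:I" (at level 1, left associativity, format "a %:I").

Declare Scope bop_scope.
Delimit Scope bop_scope with bop.
Notation "A ^*" := (adjoint A) : bop_scope.
Notation "S <= T" := (le_bop S T) : bop_scope.
Notation "`| A |" := (abs_bop A) : bop_scope.
Notation "'Re A" := (Re_bop A) : bop_scope.
Notation "'Im A" := (Im_bop A) : bop_scope.
Notation "a %:I" := (scalar_bop _ a) : bop_scope.

(* Main.v *)
Require Import Defs.
From mathcomp Require Import all_boot all_order all_algebra.
From mathcomp Require Import complex reals sesquilinear.
From mathcomp Require Import boolp classical_sets topology normedtype ring lra.

(**
Everything rests on two identities for [C A], valid as soon as [A^*] really is
the adjoint of [A]:
  - [C A - (C A)^* = (M - m) (A - A^* )], so that the skew part of [C A] is a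
    positive multiple of that of [A] ([Ctransform_sub_adjoint]); this gives the
    criteria for self-adjointness and dissipativity;
  - completing the square,
    [Re <C A x, x> = ((M - m) / 2)^2 |x|^2 - |(A - (M + m) / 2) x|^2]
    ([rinner_Ctransform]); this gives the upper bounds of the real part, and,
    the right-hand side being [(M + m) Re <A x, x> - |A x|^2 - M m |x|^2], the
    accretivity of [A] when [C A] is accretive.
The criterion for normality is the identity
[C (A^* ) - (C A)^* = A^* A - A A^*] ([Ctransform_adjoint_sub]).

The operator [|A|] is positive, hence self-adjoint, and the criterion
[m <= S <= M] for [C S] to be accretive holds for every self-adjoint [S] ([accretive_Ctransform_selfadjoint]).  If [C S] is accretive,
the square above says [|(S - c) x| <= d |x|] with [c = (M + m) / 2] and
[d = (M - m) / 2], hence [|<(S - c) x, x>| <= d |x|^2].  Conversely,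
[P = S - m] and [Q = M - S] are positive, commute and add up to [M - m], so
[(M - m) Q P = Q P Q + P Q P] is positive.

Existence of adjoints is the Riesz representation theorem.  It is proved over
the reals, for the real part of the inner product ([riesz_real]): the
representing vector of [phi] minimizes [|x|^2 - 2 phi x], and a minimizing
sequence is Cauchy by the parallelogram law.
*)

Set Implicit Arguments.
Unset Strict Implicit.
Unset Printing Implicit Defensive.

Import Order.TTheory GRing.Theory Num.Theory.
Import numFieldNormedType.Exports.

Local Open Scope ring_scope.
Local Open Scope complex_scope.

(** * Two facts about real numbers *)

Lemma sqr_le_of_quadratic_ge0 (R : realType) (a b c : R) :
  (forall t, 0 <= a * t ^+ 2 + 2 * b * t + c) -> b ^+ 2 <= a * c.
Proof.
move=> q_ge0.
have := @deg_le2_poly_ge0 R (\poly_(i < 3) [:: c; 2 * b; a]`_i) (size_poly _ _).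
rewrite !coef_poly /= => /(_ _)/wrap[t|]; last by lra.
rewrite horner_poly !big_ord_recl big_ord0 /=.
by have := q_ge0 t; rewrite /bump /= => /le_trans; apply; rewrite expr0 expr1; lra.
Qed.

Lemma exists_vanishing_seq (R : realType) :
  exists2 r : nat -> R, (forall n, 0 < r n) &
    forall e, 0 < e -> exists N, forall n, (N <= n)%N -> r n < e.
Proof.
exists (fun n => n.+1%:R^-1) => [n|e e0]; first by rewrite invr_gt0 ltr0n.
exists (Num.trunc e^-1) => n Nn; rewrite invf_plt ?posrE ?ltr0n //.
by apply: (lt_le_trans (truncnS_gt _)); rewrite ler_nat.
Qed.

(** * The underlying real inner product space *)

Section RealInner.
Context {R : realType} {H : hilbertType R}.
Implicit Types (x y z : H) (a : R).

(** Inequalities between values of [inner] or norms live in [R[i]], where the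
order is partial; taking real parts moves them to [R].  Nothing is lost, since
[rinner] determines [inner] ([inner_rinner]). *)
Definition rinner x y : R := complex.Re (inner x y).
Definition rnorm x : R := complex.Re `|x|.

Lemma innerC x y : inner x y = (inner y x)^*%C.
Proof. by rewrite (@hermC _ _ _ _ inner) /= expr0 mul1r. Qed.

Lemma innerDl x y z : inner (x + y) z = inner x z + inner y z.
Proof. exact: linearDl. Qed.

Lemma innerNl x y : inner (- x) y = - inner x y.
Proof. exact: linearNl. Qed.

Lemma innerZl (c : R[i]) x y : inner (c *: x) y = c * inner x y.
Proof. exact: linearZl_LR. Qed.

Lemma innerZr (c : R[i]) x y : inner x (c *: y) = c^*%C * inner x y.
Proof. exact: linearZr_LR. Qed.

Lemma rinnerC x y : rinner x y = rinner y x.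
Proof. by rewrite /rinner innerC; case: (inner y x). Qed.

Lemma rinnerDl x y z : rinner (x + y) z = rinner x z + rinner y z.
Proof. rewrite /rinner innerDl; exact: raddfD. Qed.

Lemma rinnerDr x y z : rinner x (y + z) = rinner x y + rinner x z.
Proof. by rewrite rinnerC rinnerDl !(rinnerC x). Qed.

Lemma rinnerZl a x y : rinner (a%:C *: x) y = a * rinner x y.
Proof.
by rewrite /rinner innerZl /=; case: (inner x y) => u v; rewrite /= mul0r subr0.
Qed.

Lemma rinnerZr a x y : rinner x (a%:C *: y) = a * rinner x y.
Proof. by rewrite rinnerC rinnerZl rinnerC. Qed.

Lemma rinnerNl x y : rinner (- x) y = - rinner x y.
Proof. rewrite /rinner innerNl; exact: raddfN. Qed.

Lemma rinnerNr x y : rinner x (- y) = - rinner x y.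
Proof. by rewrite rinnerC rinnerNl rinnerC. Qed.

Definition rinnerE := (rinnerDl, rinnerDr, rinnerNl, rinnerNr, rinnerZl, rinnerZr).

Lemma inner_rinner x y : inner x y = rinner x y +i* rinner x ('i *: y).
Proof.
rewrite /rinner innerZr.
by case: (inner x y) => u v /=; congr (_ +i* _); ring.
Qed.

(** Multiplication by ['i] is skew-adjoint for the real inner product. *)
Lemma rinner_mulir x y : rinner x ('i *: y) = - rinner ('i *: x) y.
Proof.
rewrite /rinner innerZl innerZr.
by case: (inner x y) => u v /=; ring.
Qed.

Lemma rnormE x : `|x| = (rnorm x)%:C.
Proof. by rewrite /rnorm RRe_real ?normr_real. Qed.

Lemma rnorm_ge0 x : 0 <= rnorm x.
Proof. by rewrite -ler0c -rnormE. Qed.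

Lemma rinner_sqr x : rinner x x = rnorm x ^+ 2.
Proof. by rewrite /rinner -inner_normE rnormE -rmorphXn. Qed.

Lemma rinnerxx_ge0 x : 0 <= rinner x x.
Proof. by rewrite rinner_sqr sqr_ge0. Qed.

Lemma rinnerxx_eq0 x : rinner x x = 0 -> x = 0.
Proof.
rewrite rinner_sqr => /eqP; rewrite sqrf_eq0 => /eqP x0.
by apply/normr0_eq0; rewrite rnormE x0.
Qed.

Lemma rinner_ext x y : (forall h, rinner h x = rinner h y) -> x = y.
Proof.
move=> e; apply/eqP; rewrite -subr_eq0; apply/eqP/rinnerxx_eq0.
by rewrite rinnerDr rinnerNr e subrr.
Qed.

Lemma rinner_cauchy_schwarz x y : rinner x y ^+ 2 <= rinner x x * rinner y y.
Proof.
rewrite mulrC.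
apply: sqr_le_of_quadratic_ge0 => t.
have := rinnerxx_ge0 (x + t%:C *: y); rewrite !rinnerE (rinnerC y x).
by move/le_trans; apply; lra.
Qed.

Lemma rinner_le x y : rinner x y <= rnorm x * rnorm y.
Proof.
apply: (le_trans (ler_norm _)).
rewrite -(@ler_pXn2r _ 2) ?nnegrE ?mulr_ge0 ?rnorm_ge0 //.
by rewrite real_normK ?num_real // exprMn -!rinner_sqr rinner_cauchy_schwarz.
Qed.

(** Completeness of [H], whose radii are a priori in [R[i]], in terms of real
radii. *)
Lemma rnorm_complete (u : nat -> H) :
  (forall e : R, 0 < e -> exists N, forall n k, (N <= n)%N -> (N <= k)%N ->
     rnorm (u n - u k) < e) ->
  exists y, forall e : R, 0 < e -> exists N, forall n, (N <= n)%N ->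
     rnorm (y - u n) < e.
Proof.
move=> cu.
have eps (e : R[i]) : 0 < e -> exists2 e', 0 < e' & e = e'%:C.
  move=> e0; exists (complex.Re e); last by rewrite RRe_real // gtr0_real.
  by rewrite -ltcR RRe_real // gtr0_real.
have /cauchy_cvg : cauchy ((u @ \oo)%classic).
  apply: cauchy_exP => _ /eps[e e0 ->].
  have [N uN] := cu _ e0.
  exists (u N); exists N => // n /= Nn; rewrite -ball_normE /= rnormE ltcR.
  exact: uN.
move/cvg_ex => -[y /cvgrPdist_lt uy]; exists y => e e0.
have e0C : 0 < e%:C :> R[i] by rewrite ltcR.
have [N _ yN] := uy _ e0C; exists N => n Nn.
by have := yN n Nn; rewrite /= rnormE ltcR.
Qed.

(** The functional [J x = |x|^2 - 2 phi x] is bounded below since [phi] is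
bounded.  By the parallelogram law at the midpoint, a minimizing sequence is
Cauchy; at a near-minimizer the quadratic [t |-> J (u + t h) - J u + r] is
nonnegative once [J u < inf J + r], and its discriminant bounds the defect [phi h - <h, u>], which
therefore vanishes in the limit. *)
Lemma riesz_real (phi : H -> R) (k : R) :
  (forall a x y, phi (a%:C *: x + y) = a * phi x + phi y) ->
  (forall x, phi x <= k * rnorm x) ->
  exists y, forall h, phi h = rinner h y.
Proof.
move=> phi_lin phi_bd.
have phi0 : phi 0 = 0 by have := phi_lin 1 0 0; rewrite scaler0 addr0; lra.
pose J x := rinner x x - 2 * phi x.
have J_ge x : - k ^+ 2 <= J x.
  rewrite /J rinner_sqr; have := phi_bd x; have := sqr_ge0 (rnorm x - k); lra.
have J_inf : has_inf (range J).
  by split; [exists (J 0), 0 | exists (- k ^+ 2) => _ [x _ <-]].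
pose d := inf (range J).
have d_le x : d <= J x by apply: ge_inf; [exact: J_inf.2 | exists x].
have [r r_gt0 r_small] := exists_vanishing_seq R.
have [u uP] : {u : nat -> H & forall n, J (u n) < d + r n}.
  apply: (@choice _ _ (fun n x => J x < d + r n)) => n.
  by have [_ [x _ <-] ?] := inf_adherent (r_gt0 n) J_inf; exists x.
have u_close n p : rinner (u n - u p) (u n - u p) <=
    2 * r n + 2 * r p.
  have := d_le ((2^-1)%:C *: u n + (2^-1)%:C *: u p).
  have phi_half : phi ((2^-1)%:C *: u n + (2^-1)%:C *: u p) =
      2^-1 * phi (u n) + 2^-1 * phi (u p).
    by rewrite phi_lin -[_ *: u p]addr0 phi_lin phi0 addr0.
  have := uP n; have := uP p.
  rewrite /J phi_half !rinnerE (rinnerC (u p) (u n)); lra.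
have [y uy] : exists y, forall e : R, 0 < e ->
    exists N, forall n, (N <= n)%N -> rnorm (y - u n) < e.
  apply: rnorm_complete => e e0.
  have e2 : 0 < e ^+ 2 / 4 by rewrite divr_gt0 ?exprn_gt0.
  have [N NP] := r_small _ e2; exists N => n p Nn Np.
  rewrite -(@ltr_pXn2r _ 2) ?nnegrE ?rnorm_ge0 ?(ltW e0) //.
  rewrite -rinner_sqr; apply: (le_lt_trans (u_close n p)).
  by have := NP n Nn; have := NP p Np; lra.
exists y => h; apply/eqP; rewrite -subr_eq0 -sqrf_eq0; apply/eqP/le_anti.
rewrite sqr_ge0 andbT.
pose a := rinner h h.
have a_ge0 : 0 <= a := rinnerxx_ge0 h.
have almost_critical n : (phi h - rinner h (u n)) ^+ 2 <= a * r n.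
  rewrite -sqrrN; apply: sqr_le_of_quadratic_ge0 => t.
  have := d_le (t%:C *: h + u n); have := uP n.
  rewrite /J phi_lin !rinnerE (rinnerC (u n) h) -/a; lra.
apply/ler_addgt0Pr => e e0; rewrite add0r.
(* The defect at the limit is at most twice the sum of two terms, each <= e / 4. *)
pose e' := e / (4 * (a + 1)).
have e'_gt0 : 0 < e' by rewrite divr_gt0 // mulr_gt0 // ltr_wpDl.
have a1_gt0 : 0 < a + 1 by rewrite ltr_wpDl.
have ae' : a * e' <= e / 4.
  have -> : a * e' = e / 4 * (a / (a + 1)).
    by rewrite /e'; field; rewrite lt0r_neq0.
  rewrite ler_piMr ?divr_ge0 ?(ltW e0) //.
  by rewrite ler_pdivrMr // mul1r lerDl.
have [N1 N1P] := r_small _ e'_gt0.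
have [N2 N2P] := uy (Num.sqrt e') ltac:(by rewrite sqrtr_gt0).
pose n := maxn N1 N2.
have crit : (phi h - rinner h (u n)) ^+ 2 <= e / 4.
  apply: le_trans (almost_critical n) _; apply: le_trans ae'.
  by rewrite ler_wpM2l // ltW // N1P // leq_maxl.
have dist : rinner h (y - u n) ^+ 2 <= e / 4.
  apply: le_trans (rinner_cauchy_schwarz _ _) _; apply: le_trans ae'.
  rewrite ler_wpM2l // rinner_sqr -(sqr_sqrtr (ltW e'_gt0)).
  by rewrite ler_pXn2r ?nnegrE ?rnorm_ge0 ?sqrtr_ge0 // ltW // N2P // leq_maxr.
move: crit dist; rewrite !rinnerE.
have := sqr_ge0 ((phi h - rinner h (u n)) + (rinner h y - rinner h (u n))).
lra.
Qed.

End RealInner.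

(** * Existence and algebra of adjoints *)

Section Adjoint.
Context {R : realType} {H : hilbertType R}.
Implicit Types (x y z : H) (A B S T : bop H) (a : R).

Lemma inner_adjoint_of_rinner A B :
  (forall x y, rinner (A x) y = rinner x (B y)) ->
  forall x y, inner (A x) y = inner x (B y).
Proof.
move=> AB x y; rewrite !inner_rinner AB; congr (_ +i* _).
by rewrite !rinner_mulir -AB linearZ.
Qed.

(** [x |-> Re <A x, z>] is a bounded real functional; its representing vector
depends linearly on [z] by uniqueness, and boundedly because
[|B z|^2 = Re <A (B z), z> <= k |B z| |z|]. *)
Lemma exists_adjoint A : exists B : bop H, forall x y, inner (A x) y = inner x (B y).
Proof.
have /bounded_linearP[A_lin [k Ak]] := valP A.
have Ak' x : rnorm (A x) <= k * rnorm x.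
  by have := Ak x; rewrite !rnormE -rmorphM lecR.
have represent z : {y | forall x, rinner (A x) z = rinner x y}.
  apply: cid; apply: (@riesz_real _ _ _ (k * rnorm z)) => [a x y|x].
    by rewrite A_lin !rinnerE.
  apply: le_trans (rinner_le _ _) _; rewrite mulrAC.
  by rewrite ler_wpM2r ?rnorm_ge0.
pose B z := sval (represent z).
have BP x z : rinner (A x) z = rinner x (B z) by exact: (svalP (represent z)).
have Re_conj (c : R[i]) x y : rinner x (c *: y) = rinner (c^*%C *: x) y.
  rewrite /rinner innerZl innerZr.
  by case: c (inner x y) => [? ?] [? ?] /=; ring.
have Bbd : B \in @bounded_linear R H.
  apply/bounded_linearP; split=> [c x y|].
    apply: rinner_ext => h; rewrite -BP !rinnerDr -BP; congr (_ + _).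
    by rewrite !Re_conj -BP linearZ.
  exists k => x; rewrite !rnormE -rmorphM lecR.
  have [->|Bx0] := eqVneq (rnorm (B x)) 0.
    by rewrite (le_trans (rnorm_ge0 _) (Ak' x)).
  have Bx_gt0 : 0 < rnorm (B x) by rewrite lt0r Bx0 rnorm_ge0.
  rewrite -(ler_pM2l Bx_gt0) -expr2 -rinner_sqr -BP.
  apply: le_trans (rinner_le _ _) _; rewrite mulrA (mulrC _ k).
  by rewrite ler_wpM2r ?rnorm_ge0.
exists (Bop Bbd); exact: inner_adjoint_of_rinner.
Qed.

Lemma adjointP A x y : inner (A x) y = inner x (adjoint A y).
Proof.
exact: (@xgetPex _ 0 [set B : bop H | forall x y, inner (A x) y = inner x (B y)]%classic
  (exists_adjoint A)).
Qed.

Lemma rinner_adjoint A x y : rinner (A x) y = rinner x (adjoint A y).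
Proof. by rewrite /rinner adjointP. Qed.

(** Real parts suffice to recognize the adjoint. *)
Lemma adjoint_unique A B : (forall x y, rinner (A x) y = rinner x (B y)) -> adjoint A = B.
Proof.
by move=> AB; apply: bopP => y; apply: rinner_ext => x; rewrite -rinner_adjoint.
Qed.

Lemma adjointK : involutive (@adjoint R H).
Proof.
by move=> A; apply: adjoint_unique => x y; rewrite rinnerC -rinner_adjoint rinnerC.
Qed.

Lemma bopD A B x : (A + B) x = A x + B x. Proof. by []. Qed.
Lemma bopN A x : (- A) x = - A x. Proof. by []. Qed.
Lemma bopZ (c : R[i]) A x : (c *: A) x = c *: A x. Proof. by []. Qed.
Lemma bopM A B x : (A * B) x = A (B x). Proof. by []. Qed.
Lemma bopS a x : scalar_bop H a x = a%:C *: x. Proof. by []. Qed.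
Definition bopE := (bopD, bopN, bopZ, bopM, bopS).

(** * Algebraic identities for the transform *)

Lemma CtransformE M m A : Ctransform M m A =
  M%:C *: A + m%:C *: adjoint A - adjoint A * A - scalar_bop H (M * m).
Proof.
apply: bopP => x; apply: rinner_ext => h.
by rewrite /Ctransform !bopE !rinnerE -!rinner_adjoint !rinnerE; ring.
Qed.

Lemma adjoint_Ctransform M m A : adjoint (Ctransform M m A) =
  M%:C *: adjoint A + m%:C *: A - adjoint A * A - scalar_bop H (M * m).
Proof.
rewrite CtransformE; apply: adjoint_unique => x y.
rewrite !bopE !rinnerE !rinner_adjoint adjointK; ring.
Qed.

(** * Quadratic forms and the order of operators *)

Lemma inner_Re_bop A x : inner (Re_bop A x) x = (rinner (A x) x)%:C.
Proof.
rewrite /Re_bop !bopE innerZl innerDl (innerC (adjoint A x)) -adjointP addcJ.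
by rewrite mulKf ?pnatr_eq0.
Qed.

Lemma inner_Im_bop A x : inner (Im_bop A x) x = (complex.Im (inner (A x) x))%:C.
Proof.
rewrite /Im_bop !bopE innerZl innerDl innerNl (innerC (adjoint A x)) -adjointP.
rewrite subcJ mulrAC mulKf // mulf_neq0 ?pnatr_eq0 //.
by rewrite eq_complex /= oner_eq0 andbF.
Qed.

Lemma accretiveP A : accretive A <-> forall x, 0 <= rinner (A x) x.
Proof.
by split=> A_ge0 x; move: (A_ge0 x); rewrite subr0 inner_Re_bop ler0c.
Qed.

End Adjoint.

Section Order.
Context {R : realType} {H : hilbertType R}.
Implicit Types (x y z : H) (A B S T : bop H) (a M m : R).

Lemma selfadjointP S : selfadjoint S <-> forall x y, rinner (S x) y = rinner x (S y).
Proof.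
by split=> [SS x y|]; [rewrite rinner_adjoint SS | exact: adjoint_unique].
Qed.

Lemma selfadjointB S T : selfadjoint S -> selfadjoint T -> selfadjoint (T - S).
Proof.
move=> /selfadjointP SS /selfadjointP TT; apply/selfadjointP => x y.
by rewrite !bopE !rinnerE SS TT.
Qed.

Lemma selfadjoint_scalar a : selfadjoint (scalar_bop H a).
Proof. by apply/selfadjointP => x y; rewrite !bopE !rinnerE. Qed.

Lemma selfadjoint_inner_real S x : selfadjoint S -> inner (S x) x = (rinner (S x) x)%:C.
Proof.
move=> SS; have : inner (S x) x = (inner (S x) x)^*%C.
  by rewrite -innerC adjointP SS.
rewrite /rinner; case: (inner (S x) x) => u v [v_eq].
by congr (_ +i* _); lra.
Qed.

Lemma le_bopP S T : selfadjoint S -> selfadjoint T ->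
  le_bop S T <-> forall x, rinner (S x) x <= rinner (T x) x.
Proof.
move=> SS TT.
have E x : inner ((T - S) x) x = (rinner (T x) x - rinner (S x) x)%:C.
  rewrite selfadjoint_inner_real; last exact: selfadjointB.
  by rewrite bopE bopN !rinnerE.
by split=> ST x; move: (ST x); rewrite E ler0c subr_ge0.
Qed.

(** Polarization: [Im <S x, x> = 0] for all [x] gives, at [x + 'i y], the
symmetry of [S] for the real inner product. *)
Lemma positive_selfadjoint S : le_bop 0 S -> selfadjoint S.
Proof.
move=> S_ge0; apply/selfadjointP.
have quad0 x : rinner (S x) ('i *: x) = 0.
  by have /ger0_Im := S_ge0 x; rewrite subr0 inner_rinner.
have polar x y : rinner (S x) ('i *: y) + rinner (S y) ('i *: x) = 0.
  have := quad0 (x + y).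
  by rewrite !linearD /= !rinnerE !quad0; lra.
move=> x y; have := polar x ('i *: y).
have -> : S ('i *: y) = 'i *: S y by exact: linearZ.
rewrite (rinner_mulir ('i *: S y)) !scalerA -expr2 sqr_i !scaleN1r.
by rewrite !rinnerE (rinnerC x); lra.
Qed.

(** Positivity holds for the chosen square root and also for the default value
[0] of [xget]. *)
Lemma sqrt_bop_ge0 T : le_bop 0 (sqrt_bop T).
Proof.
rewrite /sqrt_bop; case: xgetP => [S _ [] //|_] x.
rewrite subr0 (_ : (0 : bop H) x = 0%:C *: x); last by rewrite scale0r.
by rewrite innerZl mul0r.
Qed.

Lemma Re_bop_le_scalar a B :
  (forall x, rinner (B x) x <= a * rinner x x) -> le_bop (Re_bop B) (scalar_bop H a).
Proof.
move=> Ba x; rewrite bopD bopN innerDl innerNl inner_Re_bop bopS innerZl.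
rewrite -inner_normE rnormE -rmorphXn -rinner_sqr -rmorphM -rmorphB ler0c.
by rewrite subr_ge0.
Qed.

End Order.

(** * Properties of the transform *)

Section Transform.
Context {R : realType} {H : hilbertType R}.
Implicit Types (x y z : H) (A B S T : bop H) (a M m : R).

(** [M A^* + m A - M m] cancels; only the order of the quadratic term differs. *)
Lemma Ctransform_adjoint_sub M m A :
  Ctransform M m (adjoint A) - adjoint (Ctransform M m A) = adjoint A * A - A * adjoint A.
Proof.
rewrite adjoint_Ctransform CtransformE adjointK.
by apply: bopP => x; apply: rinner_ext => h; rewrite !bopE !rinnerE; ring.
Qed.

(** The terms [A^* A] and [M m] are self-adjoint, hence cancel. *)
Lemma Ctransform_sub_adjoint M m A :
  Ctransform M m A - adjoint (Ctransform M m A) = (M - m)%:C *: (A - adjoint A).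
Proof.
rewrite adjoint_Ctransform CtransformE.
by apply: bopP => x; apply: rinner_ext => h; rewrite !bopE !rinnerE; ring.
Qed.

Lemma Ctransform_normal M m A :
  Ctransform M m (adjoint A) = adjoint (Ctransform M m A) <-> normal_bop A.
Proof.
by split=> /eqP; rewrite -subr_eq0 ?Ctransform_adjoint_sub => eq0; apply/eqP;
  rewrite -subr_eq0 ?Ctransform_adjoint_sub.
Qed.

Lemma Ctransform_selfadjoint M m A : m < M ->
  Ctransform M m A = adjoint (Ctransform M m A) <-> selfadjoint A.
Proof.
move=> mM; have Mm0 : (M - m)%:C != 0 :> R[i].
  by rewrite eq_complex /= subr_eq0 gt_eqF.
split=> [/eqP|AA].
  rewrite -subr_eq0 Ctransform_sub_adjoint scaler_eq0 (negPf Mm0) /= subr_eq0.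
  by move/eqP.
by apply/eqP; rewrite -subr_eq0 Ctransform_sub_adjoint AA subrr scaler0.
Qed.

Lemma dissipative_Ctransform M m A : m < M ->
  dissipative (Ctransform M m A) <-> dissipative A.
Proof.
move=> mM.
have E x : inner (Im_bop (Ctransform M m A) x) x =
    (M - m)%:C * inner (Im_bop A x) x.
  by rewrite /Im_bop Ctransform_sub_adjoint !bopE !innerZl mulrCA.
have Mm_gt0 : 0 < (M - m)%:C :> R[i] by rewrite ltcR subr_gt0.
by split=> D x; move: (D x); rewrite !subr0 E pmulr_rge0.
Qed.

(** Completing the square in [(M - A^* ) (A - m)] around the midpoint of [m] and
[M]. *)
Lemma rinner_Ctransform M m A x (b := A x - ((M + m) / 2)%:C *: x) :
  rinner (Ctransform M m A x) x = ((M - m) / 2) ^+ 2 * rinner x x - rinner b b.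
Proof.
rewrite /b CtransformE !bopE !rinnerE (rinnerC (adjoint A (A x))) -rinner_adjoint.
rewrite (rinnerC (adjoint A x)) -rinner_adjoint (rinnerC x (A x)); lra.
Qed.

Lemma Re_Ctransform_le M m A :
  le_bop (Re_bop (Ctransform M m A)) (scalar_bop H (((M - m) / 2) ^+ 2)).
Proof.
by apply: Re_bop_le_scalar => x; rewrite rinner_Ctransform gerBl rinnerxx_ge0.
Qed.

(** [(M + m) Re <A x, x> = Re <C A x, x> + |A x|^2 + M m |x|^2]. *)
Lemma accretive_of_Ctransform M m A : 0 < m -> m < M ->
  accretive (Ctransform M m A) -> accretive A.
Proof.
move=> m_gt0 mM /accretiveP C_ge0; apply/accretiveP => x.
have Mm_gt0 : 0 < M + m by lra.
have mM_ge0 : 0 <= M * m * rinner x x by rewrite !mulr_ge0 ?rinnerxx_ge0; lra.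
rewrite -(pmulr_rge0 _ Mm_gt0).
have := C_ge0 x; rewrite rinner_Ctransform.
have := rinnerxx_ge0 (A x).
rewrite !rinnerE (rinnerC x (A x)); lra.
Qed.

(** An operator analogue of [(M - s) (s - m) >= 0 <-> m <= s <= M], obtained
without spectral theory: completing the square in one direction, and
[(M - m) Q P = Q P Q + P Q P] for [P = S - m], [Q = M - S] in the other. *)
Lemma accretive_Ctransform_selfadjoint M m S : m < M -> selfadjoint S ->
  accretive (Ctransform M m S) <->
  le_bop (scalar_bop H m) S /\ le_bop S (scalar_bop H M).
Proof.
move=> mM SS.
have sa := selfadjoint_scalar.
rewrite !le_bopP // accretiveP.
split=> [C_ge0|[mS SM] x].
  have bound x : m * rinner x x <= rinner (S x) x /\ rinner (S x) x <= M * rinner x x.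
    have [b [b_le Sx]] : exists b,
        rinner b b <= ((M - m) / 2) ^+ 2 * rinner x x /\
        rinner (S x) x = rinner b x + (M + m) / 2 * rinner x x.
      exists (S x - ((M + m) / 2)%:C *: x); split.
        by rewrite -subr_ge0 -rinner_Ctransform.
      by rewrite !rinnerE; ring.
    have [d d_gt0 d_eq] : exists2 d, 0 < d & (M - m) / 2 = d.
      by exists ((M - m) / 2); rewrite ?divr_gt0 ?subr_gt0.
    rewrite Sx; rewrite d_eq in b_le.
    (* They bound [+/- 2 d <b, x>] by [|b|^2 + d^2 |x|^2 <= 2 d^2 |x|^2]. *)
    have := rinnerxx_ge0 (b + d%:C *: x); have := rinnerxx_ge0 (b - d%:C *: x).
    rewrite !rinnerE (rinnerC x b) => ge1 ge2.
    have up : d * rinner b x <= d * (d * rinner x x) by lra.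
    have low : d * (- rinner b x) <= d * (d * rinner x x) by lra.
    by move: up low; rewrite !ler_pM2l // -d_eq; lra.
  by split=> x; rewrite bopS rinnerE; case: (bound x).
have /selfadjointP Ssym := SS.
(* [<P (Q x), Q x> + <Q (P x), P x>] is [<Q P (P + Q) x, x>]. *)
pose P z := S z - m%:C *: z; pose Q z := M%:C *: z - S z.
have P_ge0 z : 0 <= rinner (P z) z.
  by rewrite !rinnerE subr_ge0; have := mS z; rewrite bopS rinnerE.
have Q_ge0 z : 0 <= rinner (Q z) z.
  by rewrite !rinnerE subr_ge0; have := SM z; rewrite bopS rinnerE.
have Mm_gt0 : 0 < M - m by rewrite subr_gt0.
rewrite -(pmulr_rge0 _ Mm_gt0).
suff -> : (M - m) * rinner (Ctransform M m S x) x =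
    rinner (P (Q x)) (Q x) + rinner (Q (P x)) (P x).
  by rewrite addr_ge0.
rewrite CtransformE SS /P /Q !bopE !linearB /= !linearZ /= !rinnerE.
by rewrite !(Ssym (S x) x) (rinnerC x (S x)); ring.
Qed.

End Transform.

Local Open Scope bop_scope.

Theorem proposition1p1 (R : realType) (M m : R) (hm : 0 < m) (hmM : m < M)
    (H : hilbertType R) (A : bop H) :
  let C : bop H -> bop H := Ctransform M m in
  (C A^* = (C A)^* <-> normal_bop A) /\
  (C A = (C A)^* <-> selfadjoint A) /\
  (accretive (C `|A|) <-> m%:I <= `|A| /\ `|A| <= M%:I) /\
  ('Re (C ('i *: (A^*)%bop)) <= (((M - m) / 2) ^+ 2)%:I /\
   'Re (C A) <= (((M - m) / 2) ^+ 2)%:I) /\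
  (0 <= 'Im (C A) <-> 0 <= 'Im A) /\
  (0 <= 'Re (C A) -> 0 <= 'Re A) /\
  (accretive_dissipative (C A) -> accretive_dissipative A).
Proof.
split; first exact: Ctransform_normal.
split; first exact: Ctransform_selfadjoint.
split.
  apply: accretive_Ctransform_selfadjoint => //.
  exact/positive_selfadjoint/sqrt_bop_ge0.
split; first by split; apply: Re_Ctransform_le.
have im := dissipative_Ctransform A hmM.
have re := accretive_of_Ctransform hm hmM.
split; [exact: im | split; first exact: re].
by case=> /re ? /im ?; split.
Qed.
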